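(* Let $\eta_0,u_0:\mathbb{T}\to\mathbb{R}$ be functions satisfying: (A1) $1+\eta_0(x)\ge 0$ for all $x\in\mathbb{T}$; (A2) $\eta_0$ is a smooth even function such that $1+\eta_0(0)=0$ and $\partial_x^2\eta_0(0)\ge 0$; (A3) $u_0$ is a smooth odd function such that $\partial_x u_0(0)<0$. Assume that a smooth solution $(\eta,u)$ of the Serre-Green-Naghdi system, with $h=1+\eta$, $$\eta_t+\partial_x(hu)=0,$$ $$u_t-\frac{1}{3h}\partial_x\left(h^3\partial_x u_t\right)+u\,\partial_x u+\partial_x\eta-\frac{1}{3h}\partial_x\left(h^3\left(u\,\partial_x^2u-(\partial_x u)^2\right)\right)=0$$ on $\mathbb{T}$ with initial data $(\eta,u)|_{t=0}=(\eta_0,u_0)$ exists, and let $[0,T_{\max})$ be its maximal interval of existence as a smooth solution. Then the solution blows up in finite time, i.e. $T_{\max}<\infty$.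
   Context: $\mathbb{T}=[-\pi,\pi]$ with periodic boundary conditions (functions are $2\pi$-periodic in $x$). The parameters $\mu$ and $\epsilon$ of the Serre-Green-Naghdi system are set equal to $1$. Standing assumptions: $\int_{-\pi}^{\pi}\eta_0(x)\,dx=0$ (propagated in time by the first equation) and $\int_{-\pi}^{\pi}u(t,x)\,dx=0$. At points where $h=0$, the expression $\frac{1}{3h}\partial_x(h^3 w)$ is understood as $h\,(\partial_x h)\,w+\frac{h^2}{3}\partial_x w$, with which it coincides where $h\neq 0$. A smooth solution is a pair $(\eta,u)$ of smooth functions of $(x,t)$, $2\pi$-periodic in $x$, satisfying the equations. *)

(* Defs.v *)
From Stdlib Require Import Reals Lra.
From Coquelicot Require Import Coquelicot.
Open Scope R_scope.

(* Functions on the torus [-PI, PI] are represented by 2 PI-periodic functions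
   on R; a function of (t, x) is written in curried form, time first. *)
Definition periodic (f : R -> R) : Prop := forall x, f (x + 2 * PI) = f x.
Definition even_fun (f : R -> R) : Prop := forall x, f (- x) = f x.
Definition odd_fun (f : R -> R) : Prop := forall x, f (- x) = - f x.

Definition smooth (f : R -> R) : Prop := forall n x, ex_derive_n f n x.

(* C^n regularity relative to a set D of the plane. All limits are taken within
   D, so at the boundary points of D the derivatives are one-sided.  The
   partial derivatives ft, fx are unique on D when D = [0, T) x R. *)
Fixpoint Cn_on (n : nat) (D : R * R -> Prop) (f : R * R -> R) : Prop :=
  match n with
  | O => forall p, D p -> filterlim f (within D (locally p)) (locally (f p))
  | S m => exists ft fx : R * R -> R,
      (forall p, D p ->
         filterdiff f (within D (locally p))
           (fun v : R * R => ft p * fst v + fx p * snd v)) /\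
      Cn_on m D ft /\ Cn_on m D fx
  end.

(* The interval [0, T), where T may be infinite. *)
Definition in_life (T : Rbar) (t : R) : Prop := 0 <= t /\ Rbar_lt t T.

(* Smoothness on [0, T) x R, up to and including the initial time. *)
Definition smooth_on_life (T : Rbar) (f : R -> R -> R) : Prop :=
  forall n, Cn_on n (fun p => in_life T (fst p)) (fun p => f (fst p) (snd p)).

Definition Dt (f : R -> R -> R) (t x : R) : R := Derive (fun s => f s x) t.
Definition Dx (f : R -> R -> R) (t x : R) : R := Derive (fun y => f t y) x.

(* (1 / (3 h)) (h^3 w)_x, with its expanded form where h vanishes. *)
Definition dispersion (h w : R -> R) (x : R) : R :=
  if Req_EM_T (h x) 0
  then h x * Derive h x * w x + (h x) ^ 2 / 3 * Derive w x
  else 1 / (3 * h x) * Derive (fun y => (h y) ^ 3 * w y) x.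

Definition depth (eta : R -> R -> R) (t x : R) : R := 1 + eta t x.

Definition mass_eq (eta u : R -> R -> R) (t x : R) : Prop :=
  Dt eta t x + Dx (fun s y => depth eta s y * u s y) t x = 0.

Definition momentum_eq (eta u : R -> R -> R) (t x : R) : Prop :=
  Dt u t x
  - dispersion (depth eta t) (fun y => Dx (Dt u) t y) x
  + u t x * Dx u t x
  + Dx eta t x
  - dispersion (depth eta t)
      (fun y => u t y * Dx (Dx u) t y - (Dx u t y) ^ 2) x = 0.

(* The equations are imposed at t > 0, where the two-sided derivative in time
   makes sense; by smoothness up to t = 0 they then hold at t = 0 as well, with
   the one-sided time derivative. Values at t outside [0, T) play no role. *)
Record SGN_smooth_solution (T : Rbar) (eta0 u0 : R -> R)
    (eta u : R -> R -> R) : Prop := {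
  sgn_eta_smooth : smooth_on_life T eta;
  sgn_u_smooth : smooth_on_life T u;
  sgn_eta_periodic : forall t, in_life T t -> periodic (eta t);
  sgn_u_periodic : forall t, in_life T t -> periodic (u t);
  sgn_mass : forall t x, 0 < t -> Rbar_lt t T -> mass_eq eta u t x;
  sgn_momentum : forall t x, 0 < t -> Rbar_lt t T -> momentum_eq eta u t x;
  sgn_eta_init : forall x, eta 0 x = eta0 x;
  sgn_u_init : forall x, u 0 x = u0 x
}.

(* [0, T) is the maximal interval of existence of (eta, u): no smooth solution
   on a strictly longer interval coincides with (eta, u) on [0, T). *)
Definition SGN_maximal_solution (T : Rbar) (eta0 u0 : R -> R)
    (eta u : R -> R -> R) : Prop :=
  Rbar_lt 0 T /\
  SGN_smooth_solution T eta0 u0 eta u /\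
  forall (T' : Rbar) (eta' u' : R -> R -> R),
    Rbar_lt T T' ->
    SGN_smooth_solution T' eta0 u0 eta' u' ->
    ~ (forall t x, in_life T t -> eta' t x = eta t x /\ u' t x = u t x).

(* Main.v *)
From Stdlib Require Import Reals Lra Lia ClassicalEpsilon.
From Coquelicot Require Import Coquelicot.
Require Import Defs.
Open Scope R_scope.

(** The dry point travels with the flow, and at a dry point the dispersive
    terms drop out, leaving a Riccati inequality for the slope of [u].

    Suppose that the solution is global, and let [X] be the characteristic
    [X' = u(t, X)], [X(0) = 0].  It exists on every interval [[0, T]] because
    [u] and [u_x] are continuous and periodic in [x], hence bounded there
    ([characteristic_exists], from Picard iteration, [picard_lindelof]).
    Differentiate the mass equation [h_t + (h u)_x = 0] zero, one and two times
    in [x] and evaluate along [X]; with [a = u_x(t, X)] this gives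

      - [h' = - a h], so [h = 0] along [X];
      - then [(h_x)' = - 2 a h_x], so [h_x = 0], since [eta0] is even;
      - then [(h_xx)' = - 3 a h_xx], so [h_xx >= 0], by the sign of its initial
        value.

    All three are instances of [linear_ode].  For a smooth [w], the function
    [(1 / (3 h)) (h^3 w)_x = h h_x w + (h^2 / 3) w_x] is [h] times a function
    that vanishes wherever [h] and [h_x] do, so its [x]-derivative is zero on [X]
    ([dispersion_flat]).  The [x]-derivative of the momentum equation therefore
    reduces on [X] to [a' = - a^2 - h_xx <= - a^2]
    ([momentum_derived_at_vacuum]).  Since [a(0) < 0], this forces
    [T < 1 / |a(0)|] ([riccati_lifespan]), which fails for
    [T = 2 / |a(0)|].

    The equations hold for [t > 0] only, while the data are given at [t = 0].
    Time derivatives are thus taken on the open half-plane, and the quantities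
    above are carried to [t = 0] by continuity on the closed one; to have
    functions continuous on the whole line they are written
    [f (Rmax 0 t) (X t)]. *)

(** * Calculus of functions smooth on a strip *)

(** Both half-planes [t >= 0] and [t > 0] are strips. On every strip the
    [x]-derivative is two-sided; on an open one the [t]-derivative is too. *)
Definition strip (I : R -> Prop) (p : R * R) : Prop := I (fst p).

Definition smooth_on (I : R -> Prop) (f : R -> R -> R) : Prop :=
  forall n, Cn_on n (strip I) (fun p => f (fst p) (snd p)).

Lemma is_filter_lim_within (D : R * R -> Prop) (p : R * R) :
  is_filter_lim (within D (locally p)) p.
Proof. intros P HP. unfold within. revert HP. apply filter_imp. auto. Qed.

(** Differentiability along a filter passes to finer ones. Properness of [G] is
    what makes [p] its only limit, so that the defining domination is tested at
    [p] alone. It serves for smaller domains and for curves inside a domain. *)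
Lemma filterdiff_filter_le (F G : (R * R -> Prop) -> Prop) (p : R * R)
    (f l : R * R -> R) :
  ProperFilter G -> filter_le G F -> is_filter_lim F p ->
  filterdiff f F l -> filterdiff f G l.
Proof.
  intros PG GF Fp [lin dom]; split; [exact lin|].
  intros q Gq.
  assert (q = p) as ->.
  { apply (is_filter_lim_unique (K := R_AbsRing)
      (V := prod_NormedModule _ R_NormedModule R_NormedModule) (F := G));
      [exact Gq|]. exact (is_filter_lim_filter_le p GF Fp). }
  exact (is_domin_le (F := F) _ _ (dom p Fp) GF).
Qed.

Lemma within_locally_proper (D : R * R -> Prop) (p : R * R) :
  D p -> ProperFilter (within D (locally p)).
Proof.
  intros Dp; split; [|apply within_filter, _].
  intros P HP. exists p. exact (locally_singleton p _ HP Dp).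
Qed.

Lemma Cn_on_mono (D E : R * R -> Prop) :
  (forall p, E p -> D p) ->
  forall n f, Cn_on n D f -> Cn_on n E f.
Proof.
  intros ED.
  assert (le : forall p, filter_le (within E (locally p)) (within D (locally p))).
  { intros p P HP. unfold within in *. revert HP. apply filter_imp. auto. }
  induction n as [|n IH]; intros f Hf.
  - intros p Ep. intros P HP. apply le, Hf; auto.
  - destruct Hf as (ft & fx & Hd & Ht & Hx). exists ft, fx.
    split; [|split; auto].
    intros p Ep.
    apply filterdiff_filter_le with (within D (locally p)) p; auto.
    + now apply within_locally_proper.
    + apply is_filter_lim_within.
Qed.

Lemma Cn_on_ext (D : R * R -> Prop) n (f g : R * R -> R) :
  (forall p, D p -> f p = g p) -> Cn_on n D f -> Cn_on n D g.
Proof.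
  intros E; destruct n as [|n]; intros Hf.
  - intros p Dp. rewrite <- (E p Dp).
    apply filterlim_within_ext with f; [exact E|]. now apply Hf.
  - destruct Hf as (ft & fx & Hd & Ht & Hx). exists ft, fx.
    split; [|split; auto].
    intros p Dp.
    pose proof (within_locally_proper D p Dp) as PF.
    apply (filterdiff_ext_loc (K := R_AbsRing)
      (U := prod_NormedModule _ R_NormedModule R_NormedModule) f); auto.
    + unfold within. apply filter_forall. exact E.
    + intros q Hq. apply E.
      now rewrite (is_filter_lim_unique (K := R_AbsRing)
        (V := prod_NormedModule _ R_NormedModule R_NormedModule)
        q p Hq (is_filter_lim_within D p)).
Qed.

(** The chain rule for a curve inside the strip: the image of the neighbourhoods
    of [s] under the curve is a filter finer than the relative one at
    [(g1 s, g2 s)]. *)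
Lemma derive_along (I : R -> Prop) (f ft fx : R * R -> R) (g1 g2 : R -> R) (s v1 v2 : R) :
  (forall p, strip I p ->
     filterdiff f (within (strip I) (locally p))
       (fun v : R * R => ft p * fst v + fx p * snd v)) ->
  locally s (fun r => I (g1 r)) ->
  is_derive g1 s v1 -> is_derive g2 s v2 ->
  is_derive (fun r => f (g1 r, g2 r)) s
    (ft (g1 s, g2 s) * v1 + fx (g1 s, g2 s) * v2).
Proof.
  intros Hd HI H1 H2.
  pose proof (locally_singleton _ _ HI) as Is.
  specialize (Hd (g1 s, g2 s) Is).
  unfold is_derive.
  set (lh := fun a b => ft (g1 s, g2 s) * a + fx (g1 s, g2 s) * b) in *.
  apply filterdiff_ext_lin with (fun y : R => lh (scal y v1) (scal y v2)).
  2:{ intros y. unfold lh, scal; simpl; unfold mult; simpl; ring. }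
  apply (filterdiff_comp_2 (K := R_AbsRing) (F := locally s) g1 g2 (fun a b => f (a, b))
     (fun y => scal y v1) (fun y => scal y v2) lh H1 H2).
  apply (filterdiff_filter_le (within (strip I) (locally (g1 s, g2 s))) _ (g1 s, g2 s)).
  - apply filtermap_proper_filter, _.
  - intros P HP. unfold filtermap, within in *.
    assert (C : filterlim (fun r => (g1 r, g2 r)) (locally s) (locally (g1 s, g2 s))).
    { apply filterlim_locally. intros eps.
      assert (C1 : continuous g1 s) by (apply (ex_derive_continuous (K := R_AbsRing) (V := R_NormedModule)); now exists v1).
      assert (C2 : continuous g2 s) by (apply (ex_derive_continuous (K := R_AbsRing) (V := R_NormedModule)); now exists v2).
      generalize (proj1 (filterlim_locally _ _) C1 eps) (proj1 (filterlim_locally _ _) C2 eps).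
      intros A B. generalize (filter_and _ _ A B). apply filter_imp.
      intros r [X Y]. split; assumption. }
    generalize (filter_and _ _ HI (C _ HP)). apply filter_imp.
    intros r [X Y]. apply Y, X.
  - apply is_filter_lim_within.
  - revert Hd. apply filterdiff_ext. now intros [a b].
Qed.

Lemma derive_x_strip (I : R -> Prop) (f ft fx : R * R -> R) t x :
  (forall p, strip I p ->
     filterdiff f (within (strip I) (locally p))
       (fun v : R * R => ft p * fst v + fx p * snd v)) ->
  I t -> is_derive (fun y => f (t, y)) x (fx (t, x)).
Proof.
  intros Hd It.
  replace (fx (t, x)) with (ft (t, x) * 0 + fx (t, x) * 1) by ring.
  apply (derive_along I f ft fx (fun _ => t) (fun y => y) x 0 1 Hd).
  - now apply filter_forall.
  - apply (is_derive_const (K := R_AbsRing) (V := R_NormedModule) t).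
  - apply (is_derive_id (K := R_AbsRing)).
Qed.

Lemma smooth_on_is_derive_x (I : R -> Prop) (f : R -> R -> R) (t x : R) :
  smooth_on I f -> I t -> is_derive (f t) x (Dx f t x).
Proof.
  intros Hf It. destruct (Hf 1%nat) as (ft & fx & Hd & _).
  apply Derive_correct. exists (fx (t, x)).
  exact (derive_x_strip I _ ft fx t x Hd It).
Qed.

(** The witnesses [ft], [fx] in [Cn_on] may change with the order [n]; identifying
    them with the actual partial derivatives makes smoothness stable under
    differentiation. *)
Lemma smooth_on_Dx (I : R -> Prop) (f : R -> R -> R) : smooth_on I f -> smooth_on I (Dx f).
Proof.
  intros Hf n. destruct (Hf (S n)) as (ft & fx & Hd & _ & Hx).
  apply Cn_on_ext with fx; [|exact Hx].
  intros [t x] It. symmetry. apply is_derive_unique.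
  exact (derive_x_strip I _ ft fx t x Hd It).
Qed.

Lemma smooth_on_Dt (I : R -> Prop) (f : R -> R -> R) : open I -> smooth_on I f -> smooth_on I (Dt f).
Proof.
  intros oI Hf n. destruct (Hf (S n)) as (ft & fx & Hd & Ht & _).
  apply Cn_on_ext with ft; [|exact Ht].
  intros [t x] It. symmetry. apply is_derive_unique. simpl.
  replace (ft (t, x)) with (ft (t, x) * 1 + fx (t, x) * 0) by ring.
  apply (derive_along I _ ft fx (fun s => s) (fun _ => x) t 1 0 Hd).
  - exact (oI t It).
  - apply (is_derive_id (K := R_AbsRing)).
  - apply (is_derive_const (K := R_AbsRing) (V := R_NormedModule) x).
Qed.

Lemma smooth_on_chain (I : R -> Prop) (f : R -> R -> R) (X : R -> R) (t v : R) :
  open I -> smooth_on I f -> I t -> is_derive X t v ->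
  is_derive (fun s => f s (X s)) t (Dt f t (X t) + Dx f t (X t) * v).
Proof.
  intros oI Hf It HX. destruct (Hf 1%nat) as (ft & fx & Hd & _).
  assert (A : forall (Y : R -> R) w, is_derive Y t w ->
    is_derive (fun s => f s (Y s)) t (ft (t, Y t) * 1 + fx (t, Y t) * w)).
  { intros Y w HY.
    apply (derive_along I _ ft fx (fun s => s) Y t 1 w Hd (oI t It)); [|exact HY].
    apply (is_derive_id (K := R_AbsRing)). }
  assert (Et : Dt f t (X t) = ft (t, X t)).
  { apply is_derive_unique.
    replace (ft (t, X t)) with (ft (t, X t) * 1 + fx (t, X t) * 0) by ring.
    apply (A (fun _ => X t)).
    apply (is_derive_const (K := R_AbsRing) (V := R_NormedModule) (X t)). }
  assert (Ex : Dx f t (X t) = fx (t, X t)).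
  { apply is_derive_unique. exact (derive_x_strip I _ ft fx t (X t) Hd It). }
  rewrite Et, Ex, <- (Rmult_1_r (ft _)). now apply A.
Qed.

Lemma smooth_on_is_derive_t (I : R -> Prop) (f : R -> R -> R) (t x : R) :
  open I -> smooth_on I f -> I t -> is_derive (fun s => f s x) t (Dt f t x).
Proof.
  intros oI Hf It.
  replace (Dt f t x) with (Dt f t x + Dx f t x * 0) by ring.
  apply (smooth_on_chain I f (fun _ => x)); auto.
  apply (is_derive_const (K := R_AbsRing) (V := R_NormedModule) x).
Qed.

Lemma smooth_on_continuity (I : R -> Prop) (f : R -> R -> R) (t x : R) :
  open I -> smooth_on I f -> I t -> continuity_2d_pt f t x.
Proof.
  intros oI Hf It. apply continuity_2d_pt_filterlim.
  intros P HP. generalize (Hf 0%nat (t, x) It P HP).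
  unfold filtermap, within. intros H.
  assert (J : locally (t, x) (fun p => strip I p)).
  { destruct (oI t It) as [e He]. exists e. intros p [Hp _]. now apply He. }
  generalize (filter_and _ _ H J). apply filter_imp. simpl. intuition.
Qed.

Lemma smooth_on_Schwarz (I : R -> Prop) (f : R -> R -> R) (t x : R) :
  open I -> smooth_on I f -> I t -> Dt (Dx f) t x = Dx (Dt f) t x.
Proof.
  intros oI Hf It.
  pose proof (smooth_on_Dx I f Hf) as Hfx.
  pose proof (smooth_on_Dt I f oI Hf) as Hft.
  apply (Schwarz f t x).
  - destruct (oI t It) as [e He]. exists e. intros s y Hs _.
    assert (Is : I s) by (apply He; exact Hs).
    repeat split.
    + exists (Dt f s y). now apply smooth_on_is_derive_t with I.
    + exists (Dx f s y). now apply (smooth_on_is_derive_x I).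
    + exists (Dt (Dx f) s y). now apply (smooth_on_is_derive_t I (Dx f)).
    + exists (Dx (Dt f) s y). now apply (smooth_on_is_derive_x I (Dt f)).
  - apply (smooth_on_continuity I (Dt (Dx f))); auto. now apply smooth_on_Dt.
  - apply (smooth_on_continuity I (Dx (Dt f))); auto. now apply smooth_on_Dx.
Qed.

Lemma smooth_on_mono (I J : R -> Prop) f :
  (forall t, J t -> I t) -> smooth_on I f -> smooth_on J f.
Proof.
  intros JI Hf n. apply Cn_on_mono with (strip I); auto. intros p. apply JI.
Qed.

(** Composing with a map [tau] into the strip, such as [Rmax 0], extends a
    function given on a closed strip continuously to the whole plane. *)
Lemma smooth_on_continuity_comp (I : R -> Prop) (f : R -> R -> R) (tau : R -> R) (s x : R) :
  smooth_on I f -> (forall r, I (tau r)) -> continuous tau s ->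
  continuity_2d_pt (fun r y => f (tau r) y) s x.
Proof.
  intros Hf HI Htau. apply continuity_2d_pt_filterlim.
  intros P HP. generalize (Hf 0%nat (tau s, x) (HI s) P HP).
  unfold filtermap, within. intros [e He].
  destruct (proj1 (filterlim_locally _ _) Htau e) as [d Hd].
  exists (mkposreal _ (Rmin_stable_in_posreal e d)).
  intros [r y] [Hr Hy]; simpl in *.
  refine (He (tau r, y) _ (HI r)). split; simpl.
  - apply Hd. apply (ball_le _ _ _ (Rmin_r e d)) in Hr. exact Hr.
  - apply (ball_le _ _ _ (Rmin_l e d)) in Hy. exact Hy.
Qed.

(** * The Picard-Lindelof theorem *)

Lemma continuous_comp_2d (v : R -> R -> R) (g1 g2 : R -> R) (s : R) :
  continuity_2d_pt v (g1 s) (g2 s) -> continuous g1 s -> continuous g2 s ->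
  continuous (fun r => v (g1 r) (g2 r)) s.
Proof.
  intros Hv H1 H2. apply continuous_comp_2; auto.
  now apply continuity_2d_pt_filterlim in Hv.
Qed.

Lemma lipschitz_continuous (g : R -> R) (M s : R) :
  (forall a b, Rabs (g b - g a) <= M * Rabs (b - a)) -> continuous g s.
Proof.
  intros Hg. apply filterlim_locally. intros e.
  assert (M0 : 0 <= M).
  { generalize (Hg 0 1) (Rabs_pos (g 1 - g 0)). rewrite Rminus_0_r, Rabs_R1. lra. }
  assert (d0 : 0 < e / (M + 1)) by (apply Rdiv_lt_0_compat; [apply cond_pos|lra]).
  exists (mkposreal _ d0). intros r Hr.
  change (Rabs (r - s) < e / (M + 1)) in Hr.
  change (Rabs (g r - g s) < e).
  apply Rle_lt_trans with (1 := Hg s r).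
  apply Rle_lt_trans with ((M + 1) * Rabs (r - s)).
  - generalize (Rabs_pos (r - s)). nra.
  - apply Rmult_lt_compat_l with (r := M + 1) in Hr; [|lra].
    replace ((M + 1) * (e / (M + 1))) with (pos e) in Hr by (field; lra). exact Hr.
Qed.

Lemma Rmax_0_lipschitz (a b : R) : Rabs (Rmax 0 b - Rmax 0 a) <= Rabs (b - a).
Proof.
  apply Rabs_le.
  generalize (Rle_abs (b - a)) (Rle_abs (- (b - a))). rewrite Rabs_Ropp.
  unfold Rmax. destruct (Rle_dec 0 a), (Rle_dec 0 b); lra.
Qed.

Lemma continuous_Rmax_0 (s : R) : continuous (Rmax 0) s.
Proof.
  apply lipschitz_continuous with 1. intros a b. rewrite Rmult_1_l.
  apply Rmax_0_lipschitz.
Qed.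

Lemma lim_seq_le_const (w : nat -> R) (l B : R) :
  (forall n, w n <= B) -> is_lim_seq w l -> l <= B.
Proof.
  intros HB Hw.
  exact (is_lim_seq_le w (fun _ => B) l B HB Hw (is_lim_seq_const B)).
Qed.

Section Picard.

Variables (v : R -> R -> R) (x0 M L : R).
Hypothesis v_cont : forall s x, continuity_2d_pt v s x.
Hypothesis v_bound : forall s x, Rabs (v s x) <= M.
Hypothesis L_pos : 0 < L.
Hypothesis v_lip : forall s x y, Rabs (v s x - v s y) <= L * Rabs (x - y).

(** Stopping the integral at [Rmax 0 t] freezes the iterates at [x0] in the past, so
    that they are Lipschitz on the whole line. *)
Fixpoint picard (n : nat) (t : R) : R :=
  match n with
  | O => x0
  | S m => x0 + RInt (fun s => v s (picard m s)) 0 (Rmax 0 t)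
  end.

Lemma ex_RInt_along (g : R -> R) (a b : R) :
  (forall s, continuous g s) -> ex_RInt (fun s => v s (g s)) a b.
Proof.
  intros Hg. apply (ex_RInt_continuous (V := R_CompleteNormedModule)).
  intros s _. apply (continuous_comp_2d v (fun s => s) g); auto.
  apply continuous_id.
Qed.

Lemma integral_lipschitz (g : R -> R) :
  (forall s, continuous g s) -> forall a b,
  Rabs (RInt (fun s => v s (g s)) 0 (Rmax 0 b) - RInt (fun s => v s (g s)) 0 (Rmax 0 a))
    <= M * Rabs (b - a).
Proof.
  intros Hg.
  assert (M0 : 0 <= M) by (apply Rle_trans with (2 := v_bound 0 0); apply Rabs_pos).
  assert (W : forall a b, a <= b ->
    Rabs (RInt (fun s => v s (g s)) 0 b - RInt (fun s => v s (g s)) 0 a) <= M * (b - a)).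
  { intros a b ab.
    rewrite <- (RInt_Chasles (fun s => v s (g s)) 0 a b) by now apply ex_RInt_along.
    match goal with |- Rabs ?e <= _ =>
      replace e with (RInt (fun s => v s (g s)) a b) by (change plus with Rplus; lra) end.
    rewrite Rmult_comm. apply abs_RInt_le_const; auto. now apply ex_RInt_along. }
  assert (W' : forall a b,
    Rabs (RInt (fun s => v s (g s)) 0 b - RInt (fun s => v s (g s)) 0 a)
      <= M * Rabs (b - a)).
  { intros a b. destruct (Rle_dec a b) as [ab|ab].
    - rewrite (Rabs_pos_eq (b - a)) by lra. now apply W.
    - rewrite Rabs_minus_sym, (Rabs_minus_sym b a), (Rabs_pos_eq (a - b)) by lra.
      apply W; lra. }
  intros a b. eapply Rle_trans; [apply W'|].
  apply Rmult_le_compat_l; [exact M0|apply Rmax_0_lipschitz].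
Qed.

Lemma picard_lipschitz n : forall a b,
  Rabs (picard n b - picard n a) <= M * Rabs (b - a).
Proof.
  induction n as [|n IH]; intros a b; simpl.
  - unfold Rminus at 1. rewrite Rplus_opp_r, Rabs_R0.
    apply Rmult_le_pos; [|apply Rabs_pos].
    apply Rle_trans with (2 := v_bound 0 0); apply Rabs_pos.
  - match goal with |- Rabs (x0 + ?p - (x0 + ?q)) <= _ =>
      replace (x0 + p - (x0 + q)) with (p - q) by lra end.
    apply integral_lipschitz.
    intros s. apply lipschitz_continuous with M, IH.
Qed.

Lemma picard_continuous n s : continuous (picard n) s.
Proof. apply lipschitz_continuous with M, picard_lipschitz. Qed.

(** In the norm weighted by [exp (- 2 L t)] the Picard map contracts by the factor
    [1/2] on all of [t >= 0], with no restriction to short times. *)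
Let weight t := exp (2 * L * t).
Let C := M / (2 * L).

(** The contraction: the primitive of [L K exp (2 L t)] is [(K / 2) exp (2 L t)]. *)
Lemma integral_gap (g1 g2 : R -> R) (K t : R) :
  (forall s, continuous g1 s) -> (forall s, continuous g2 s) ->
  (forall s, 0 <= s -> Rabs (g1 s - g2 s) <= K * weight s) -> 0 <= t -> 0 <= K ->
  Rabs (RInt (fun s => v s (g1 s)) 0 t - RInt (fun s => v s (g2 s)) 0 t)
    <= K / 2 * weight t.
Proof.
  intros H1 H2 HK t0 K0.
  change (Rabs (minus (RInt (fun s => v s (g1 s)) 0 t) (RInt (fun s => v s (g2 s)) 0 t))
    <= K / 2 * weight t).
  rewrite <- RInt_minus by now apply ex_RInt_along.
  assert (P : is_RInt (fun s => L * K * weight s) 0 t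
                (minus (K / 2 * weight t) (K / 2 * weight 0))).
  { apply (is_RInt_derive (V := R_CompleteNormedModule) (fun s => K / 2 * weight s)).
    - intros s _. unfold weight. auto_derive; [easy|].
      unfold Rdiv. field.
    - intros s _. apply (ex_derive_continuous (K := R_AbsRing) (V := R_NormedModule)).
      unfold weight. now auto_derive. }
  apply Rle_trans with (minus (K / 2 * weight t) (K / 2 * weight 0)).
  - apply (norm_RInt_le (V := R_NormedModule)
      (fun s => minus (v s (g1 s)) (v s (g2 s))) (fun s => L * K * weight s) 0 t _ _ t0).
    + intros s [s0 _]. apply Rle_trans with (1 := v_lip s (g1 s) (g2 s)).
      rewrite Rmult_assoc. apply Rmult_le_compat_l; [lra|]. now apply HK.
    + apply (RInt_correct (V := R_CompleteNormedModule)).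
      apply (ex_RInt_minus (V := R_NormedModule)); now apply ex_RInt_along.
    + exact P.
  - unfold minus, plus, opp; simpl.
    assert (0 < weight 0) by apply exp_pos. nra.
Qed.

Lemma weight_ge1 t : 0 <= t -> 1 <= weight t /\ 2 * L * t <= weight t.
Proof.
  intros t0. unfold weight.
  assert (E : 1 + 2 * L * t <= exp (2 * L * t)).
  { destruct (Req_dec (2 * L * t) 0) as [->|N].
    - rewrite exp_0; lra.
    - apply Rlt_le, exp_ineq1, N. }
  assert (0 <= 2 * L * t) by (apply Rmult_le_pos; lra).
  lra.
Qed.

Lemma C_nonneg : 0 <= C.
Proof.
  apply Rmult_le_pos; [|left; apply Rinv_0_lt_compat; lra].
  apply Rle_trans with (2 := v_bound 0 0); apply Rabs_pos.
Qed.

Lemma picard_step n t : 0 <= t ->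
  Rabs (picard (S n) t - picard n t) <= C * (/ 2) ^ n * weight t.
Proof.
  revert t. induction n as [|n IH]; intros t t0.
  - simpl. rewrite Rmax_right by exact t0.
    match goal with |- Rabs (x0 + ?p - x0) <= _ =>
      replace (x0 + p - x0) with p by lra end.
    apply Rle_trans with ((t - 0) * M).
    + apply abs_RInt_le_const; auto.
      apply (ex_RInt_along (fun _ => x0)). intros s; apply continuous_const.
    + destruct (weight_ge1 t t0) as [_ W].
      rewrite Rmult_1_r. replace ((t - 0) * M) with (C * (2 * L * t)).
      * apply Rmult_le_compat_l; [apply C_nonneg|exact W].
      * unfold C. field. lra.
  - change (Rabs ((x0 + RInt (fun s => v s (picard (S n) s)) 0 (Rmax 0 t))
      - (x0 + RInt (fun s => v s (picard n s)) 0 (Rmax 0 t)))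
      <= C * (/ 2) ^ S n * weight t).
    rewrite Rmax_right by exact t0.
    match goal with |- Rabs (x0 + ?p - (x0 + ?q)) <= _ =>
      replace (x0 + p - (x0 + q)) with (p - q) by lra end.
    replace (C * (/ 2) ^ S n) with (C * (/ 2) ^ n / 2) by (simpl; field).
    apply integral_gap; auto using picard_continuous.
    apply Rmult_le_pos; [apply C_nonneg|]. apply pow_le; lra.
Qed.

Lemma picard_tail n k t : 0 <= t ->
  Rabs (picard (n + k) t - picard n t) <= 2 * C * (/ 2) ^ n * weight t.
Proof.
  intros t0.
  assert (T : Rabs (picard (n + k) t - picard n t)
    <= 2 * C * ((/ 2) ^ n - (/ 2) ^ (n + k)) * weight t).
  { induction k as [|k IH].
    - rewrite Nat.add_0_r, !Rminus_diag, Rabs_R0. lra.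
    - replace (n + S k)%nat with (S (n + k)) by lia.
      pose proof (picard_step (n + k) t t0) as S1.
      replace (picard (S (n + k)) t - picard n t) with
        ((picard (S (n + k)) t - picard (n + k) t) + (picard (n + k) t - picard n t)) by ring.
      eapply Rle_trans; [apply Rabs_triang|].
      eapply Rle_trans; [apply Rplus_le_compat; [exact S1|exact IH]|].
      right. simpl. field. }
  apply Rle_trans with (1 := T).
  apply Rmult_le_compat_r; [left; apply exp_pos|].
  apply Rmult_le_compat_l; [generalize C_nonneg; lra|].
  assert (0 < (/ 2) ^ (n + k)) by (apply pow_lt; lra). lra.
Qed.

Definition picard_limit (t : R) : R := real (Lim_seq (fun n => picard n (Rmax 0 t))).

Lemma geometric_vanishes (K : R) : is_lim_seq (fun n => K * (/ 2) ^ n) 0.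
Proof.
  replace (Finite 0) with (Rbar_mult K 0) by (simpl; f_equal; ring).
  apply is_lim_seq_scal_l, is_lim_seq_geom. rewrite Rabs_pos_eq; lra.
Qed.

Lemma picard_converges t : is_lim_seq (fun n => picard n (Rmax 0 t)) (picard_limit t).
Proof.
  apply Lim_seq_correct', ex_lim_seq_cauchy_corr. intros e.
  pose proof (Rmax_l 0 t) as T0.
  set (r := Rmax 0 t) in *.
  pose proof (geometric_vanishes (2 * C * weight r)) as G.
  apply is_lim_seq_spec in G.
  destruct (G (mkposreal _ (is_pos_div_2 e))) as [N HN]. simpl in HN.
  assert (Hn : forall n, (N <= n)%nat -> Rabs (picard n r - picard N r) < e / 2).
  { intros n Nn. replace n with (N + (n - N))%nat by lia.
    eapply Rle_lt_trans; [apply picard_tail, T0|].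
    specialize (HN N (Nat.le_refl N)).
    rewrite Rminus_0_r in HN. apply Rabs_lt_between in HN. lra. }
  exists N. intros n m Hn' Hm'.
  pose proof (Hn n Hn') as A. pose proof (Hn m Hm') as B.
  apply Rabs_lt_between in A. apply Rabs_lt_between in B.
  apply Rabs_lt_between. lra.
Qed.

Lemma picard_limit_rate n t : 0 <= t ->
  Rabs (picard_limit t - picard n t) <= 2 * C * (/ 2) ^ n * weight t.
Proof.
  intros t0.
  pose proof (picard_converges t) as H. rewrite Rmax_right in H by exact t0.
  apply (is_lim_seq_incr_n _ n) in H.
  assert (H' : is_lim_seq (fun k => Rabs (picard (k + n) t - picard n t))
                 (Rabs (picard_limit t - picard n t))).
  { apply (is_lim_seq_abs _ (Finite (picard_limit t - picard n t))).
    apply is_lim_seq_minus'; [exact H|apply is_lim_seq_const]. }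
  apply lim_seq_le_const with (2 := H').
  intros k. rewrite Nat.add_comm. now apply picard_tail.
Qed.

Lemma picard_limit_lipschitz a b :
  Rabs (picard_limit b - picard_limit a) <= M * Rabs (b - a).
Proof.
  assert (H : is_lim_seq (fun n => Rabs (picard n (Rmax 0 b) - picard n (Rmax 0 a)))
                (Rabs (picard_limit b - picard_limit a))).
  { apply (is_lim_seq_abs _ (Finite (picard_limit b - picard_limit a))).
    apply is_lim_seq_minus'; apply picard_converges. }
  apply lim_seq_le_const with (2 := H).
  intros n. eapply Rle_trans; [apply picard_lipschitz|].
  apply Rmult_le_compat_l.
  - apply Rle_trans with (2 := v_bound 0 0); apply Rabs_pos.
  - apply Rmax_0_lipschitz.
Qed.

Lemma picard_limit_continuous s : continuous picard_limit s.
Proof. apply lipschitz_continuous with M, picard_limit_lipschitz. Qed.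

Lemma picard_limit_integral t : 0 <= t ->
  picard_limit t = x0 + RInt (fun s => v s (picard_limit s)) 0 t.
Proof.
  intros t0.
  pose proof (picard_converges t) as H. rewrite Rmax_right in H by exact t0.
  apply is_lim_seq_incr_1 in H.
  assert (G : is_lim_seq (fun n => picard (S n) t)
                (x0 + RInt (fun s => v s (picard_limit s)) 0 t)).
  { apply (is_lim_seq_le_le
      (fun n => x0 + RInt (fun s => v s (picard_limit s)) 0 t - C * weight t * (/ 2) ^ n) _
      (fun n => x0 + RInt (fun s => v s (picard_limit s)) 0 t + C * weight t * (/ 2) ^ n)).
    - intros n.
      pose proof (integral_gap (picard n) picard_limit (2 * C * (/ 2) ^ n) t) as A.
      assert (B : Rabs (RInt (fun s => v s (picard n s)) 0 t
        - RInt (fun s => v s (picard_limit s)) 0 t) <= C * weight t * (/ 2) ^ n).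
      { replace (C * weight t * (/ 2) ^ n) with (2 * C * (/ 2) ^ n / 2 * weight t) by field.
        apply A; auto using picard_continuous, picard_limit_continuous.
        - intros s s0. rewrite Rabs_minus_sym. now apply picard_limit_rate.
        - apply Rmult_le_pos; [generalize C_nonneg; lra|]. apply pow_le; lra. }
      apply Rabs_le_between in B. simpl. rewrite Rmax_right by exact t0. lra.
    - rewrite <- (Rminus_0_r (x0 + _)) at 1.
      apply is_lim_seq_minus'; [apply is_lim_seq_const|apply geometric_vanishes].
    - rewrite <- (Rplus_0_r (x0 + _)) at 1.
      apply is_lim_seq_plus'; [apply is_lim_seq_const|apply geometric_vanishes]. }
  apply is_lim_seq_unique in H. apply is_lim_seq_unique in G. congruence.
Qed.

(** The uniform bounds make the solution global in positive time. It is
    continuous on the whole line, which handles the initial time without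
    one-sided limits. *)
Lemma picard_lindelof :
  exists X : R -> R, X 0 = x0 /\ (forall t, continuous X t) /\
    forall t, 0 < t -> is_derive X t (v t (X t)).
Proof.
  exists picard_limit. split; [|split].
  - rewrite picard_limit_integral by lra. rewrite RInt_point. change zero with 0. lra.
  - apply picard_limit_continuous.
  - intros t t0.
    apply is_derive_ext_loc with (fun t => x0 + RInt (fun s => v s (picard_limit s)) 0 t).
    { exists (mkposreal t t0). intros s Hs. symmetry. apply picard_limit_integral.
      change (Rabs (s - t) < t) in Hs. apply Rabs_lt_between in Hs. lra. }
    replace (v t (picard_limit t)) with (plus 0 (v t (picard_limit t)))
      by (change plus with Rplus; lra).
    apply (is_derive_plus (K := R_AbsRing) (V := R_NormedModule)).
    + apply (is_derive_const (K := R_AbsRing) (V := R_NormedModule)).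
    + apply (is_derive_RInt (V := R_NormedModule) (fun s => v s (picard_limit s)) _ 0).
      * apply filter_forall. intros s.
        apply (RInt_correct (V := R_CompleteNormedModule)).
        apply ex_RInt_along, picard_limit_continuous.
      * apply (continuous_comp_2d v (fun s => s) picard_limit); auto.
        -- apply continuous_id.
        -- apply picard_limit_continuous.
Qed.

End Picard.

(** * Boundedness of periodic functions *)

(** A Lebesgue-number argument. The radius at each point is taken below both the
    modulus of continuity for gap 1 and [1 / (1 + |g|)]: a positive lower bound
    [r] for the radii then also bounds [|g|], through [1 + |g| <= 1 / r]. *)
Lemma continuity_2d_bounded (g : R -> R -> R) (a b c d : R) :
  (forall s x, continuity_2d_pt g s x) ->
  exists M, forall s x, a <= s <= b -> c <= x <= d -> Rabs (g s x) <= M.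
Proof.
  intros Hg.
  assert (H : forall p : R * R, exists e : posreal,
    (e <= / (1 + Rabs (g (fst p) (snd p)))) /\
    forall s x, Rabs (s - fst p) < e -> Rabs (x - snd p) < e ->
      Rabs (g s x - g (fst p) (snd p)) < 1).
  { intros [s0 x0]; simpl.
    destruct (Hg s0 x0 (mkposreal 1 Rlt_0_1)) as [e He].
    assert (k : 0 < / (1 + Rabs (g s0 x0))).
    { apply Rinv_0_lt_compat. generalize (Rabs_pos (g s0 x0)). lra. }
    exists (mkposreal _ (Rmin_stable_in_posreal e (mkposreal _ k))). simpl. split.
    - apply Rmin_r.
    - intros s x Hs Hx. apply He; eapply Rlt_le_trans; eauto using Rmin_l. }
  set (delta s x := proj1_sig (constructive_indefinite_description _ (H (s, x)))).
  destruct (compactness_value_2d a b c d delta) as [r Hr].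
  exists (/ r). intros s x Hs Hx.
  destruct (Rle_dec (Rabs (g s x)) (/ r)) as [|N]; [easy|exfalso].
  apply (Hr s x Hs Hx). intros (s1 & x1 & _ & _ & Ks & Kx & Kr). apply N.
  unfold delta in Ks, Kx, Kr.
  destruct (constructive_indefinite_description _ (H (s1, x1))) as [e [E1 E2]].
  simpl in *.
  specialize (E2 s x Ks Kx).
  pose proof (cond_pos r) as r0.
  assert (1 + Rabs (g s1 x1) <= / r).
  { assert (K : 0 < 1 + Rabs (g s1 x1)) by (generalize (Rabs_pos (g s1 x1)); lra).
    rewrite <- (Rinv_inv (1 + Rabs (g s1 x1))).
    apply Rinv_le_contravar; lra. }
  generalize (Rabs_triang_inv (g s x) (g s1 x1)). lra.
Qed.

Lemma periodic_representative (f : R -> R) (x : R) :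
  periodic f -> exists y, - PI <= y <= PI /\ f y = f x.
Proof.
  intros Hf. pose proof PI_RGT_0 as pi0.
  (* Each step moves [z] by one period towards the origin. *)
  assert (W : forall n z, Rabs z <= PI + 2 * PI * INR n ->
    exists y, - PI <= y <= PI /\ f y = f z).
  { induction n as [|n IH]; intros z Hz.
    - exists z. split; [|easy]. apply Rabs_le_between. simpl in Hz. lra.
    - rewrite S_INR in Hz. pose proof (pos_INR n) as n0.
      apply Rabs_le_between in Hz.
      destruct (Rlt_dec PI z) as [Hp|Hp].
      + destruct (IH (z - 2 * PI)) as (y & Hy & E).
        { apply Rabs_le_between. nra. }
        exists y. split; [easy|]. rewrite E, <- Hf. f_equal. ring.
      + destruct (Rlt_dec z (- PI)) as [Hm|Hm].
        * destruct (IH (z + 2 * PI)) as (y & Hy & E).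
          { apply Rabs_le_between. nra. }
          exists y. split; [easy|]. rewrite E. apply Hf.
        * exists z. split; [lra|easy]. }
  destruct (INR_unbounded (Rabs x)) as [n Hn].
  apply (W n). pose proof PI2_1. pose proof (pos_INR n). nra.
Qed.

Lemma Derive_periodic (f : R -> R) : periodic f -> periodic (Derive f).
Proof.
  intros Hf x. unfold Derive. f_equal.
  apply Lim_ext. intros y.
  replace (x + 2 * PI + y) with (x + y + 2 * PI) by ring. now rewrite !Hf.
Qed.

Lemma periodic_bounded (f : R -> R -> R) (T : R) :
  smooth_on (Rle 0) f -> (forall t, 0 <= t -> periodic (f t)) ->
  exists M, forall t x, 0 <= t <= T -> Rabs (f t x) <= M.
Proof.
  intros Hf Hp.
  destruct (continuity_2d_bounded (fun s y => f (Rmax 0 s) y) 0 T (- PI) PI) as [M HM].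
  { intros s x. apply (smooth_on_continuity_comp (Rle 0)); auto using Rmax_l.
    apply continuous_Rmax_0. }
  exists M. intros t x Ht.
  destruct (periodic_representative (f t) x) as (y & Hy & <-); [now apply Hp|].
  specialize (HM t y Ht Hy). now rewrite Rmax_right in HM.
Qed.

(** * Scalar differential equations *)

Lemma is_derive_Rmult (f g : R -> R) (x df dg : R) :
  is_derive f x df -> is_derive g x dg ->
  is_derive (fun y => f y * g y) x (df * g x + f x * dg).
Proof.
  intros Hf Hg. apply is_derive_Reals.
  apply derivable_pt_lim_mult; now apply is_derive_Reals.
Qed.

Lemma is_derive_Rplus (f g : R -> R) (x df dg : R) :
  is_derive f x df -> is_derive g x dg ->
  is_derive (fun y => f y + g y) x (df + dg).
Proof. apply (is_derive_plus (K := R_AbsRing) (V := R_NormedModule)). Qed.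

Lemma is_derive_Ropp (f : R -> R) (x df : R) :
  is_derive f x df -> is_derive (fun y => - f y) x (- df).
Proof. apply (is_derive_opp (K := R_AbsRing) (V := R_NormedModule)). Qed.

Lemma is_derive_1plus (f : R -> R) (x df : R) :
  is_derive f x df -> is_derive (fun y => 1 + f y) x df.
Proof.
  intros Hf. rewrite <- (Rplus_0_l df). apply is_derive_Rplus; auto.
  apply (is_derive_const (K := R_AbsRing) (V := R_NormedModule)).
Qed.

(** The product [f exp (int g)] is constant. The formula shows at once that a zero
    initial value stays zero and that a nonnegative one stays nonnegative. *)
Lemma linear_ode (f g : R -> R) (T t : R) :
  (forall s, continuous f s) -> (forall s, continuous g s) ->
  (forall s, 0 < s < T -> is_derive f s (- g s * f s)) ->
  0 <= t <= T -> f t = f 0 * exp (- RInt g 0 t).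
Proof.
  intros Hf Hg Hd [t0 tT].
  assert (HG : forall s, is_derive (fun r => RInt g 0 r) s (g s)).
  { intros s. apply (is_derive_RInt (V := R_NormedModule) g _ 0); auto.
    apply filter_forall. intros r. apply (RInt_correct (V := R_CompleteNormedModule)).
    apply (ex_RInt_continuous (V := R_CompleteNormedModule)). auto. }
  assert (HE : forall s, is_derive (fun r => exp (RInt g 0 r)) s (g s * exp (RInt g 0 s))).
  { intros s. apply (is_derive_comp (K := R_AbsRing) (V := R_NormedModule) exp (fun r => RInt g 0 r)).
    - apply is_derive_exp.
    - apply HG. }
  destruct (MVT_gen (fun r => f r * exp (RInt g 0 r)) 0 t (fun _ => 0)) as (c & _ & E).
  - rewrite Rmin_left, Rmax_right by easy. intros s Hs.
    assert (sT : 0 < s < T) by lra.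
    pose proof (is_derive_Rmult f (fun r => exp (RInt g 0 r)) s _ _ (Hd s sT) (HE s)) as K.
    cbv beta in K.
    match type of K with is_derive _ _ ?e => replace e with 0 in K by ring end.
    exact K.
  - intros s _. apply continuity_pt_filterlim.
    apply (continuous_mult (K := R_AbsRing) f (fun r => exp (RInt g 0 r))); [apply Hf|].
    apply (ex_derive_continuous (K := R_AbsRing) (V := R_NormedModule)).
    eexists; apply HE.
  - rewrite RInt_point in E. change zero with 0 in E. rewrite exp_0 in E.
    rewrite exp_Ropp. apply Rmult_eq_reg_r with (exp (RInt g 0 t)).
    + field_simplify; [lra|]. apply Rgt_not_eq, exp_pos.
    + apply Rgt_not_eq, exp_pos.
Qed.

(** As long as [a] exists it stays negative, and [1 / a] grows at a rate at least 1
    from [1 / a 0] while remaining negative. *)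
Lemma riccati_lifespan (a da : R -> R) (T : R) :
  (forall s, continuous a s) ->
  (forall s, 0 < s < T -> is_derive a s (da s) /\ da s <= - a s ^ 2) ->
  a 0 < 0 -> 0 <= T -> T * - a 0 < 1.
Proof.
  intros Ha Hd a0 T0.
  assert (Hc : forall s, continuity_pt a s) by (intros; apply continuity_pt_filterlim, Ha).
  assert (D : forall t, 0 <= t <= T -> a t <= a 0).
  { intros t [t0 tT]. destruct (Req_dec t 0) as [->|]; [lra|].
    (* The mean value theorem may return an endpoint, where nothing is known of
       [da]; there the value 0 keeps the conclusion true. *)
    destruct (MVT_gen a 0 t (fun s => if Rlt_dec 0 s then if Rlt_dec s T then da s else 0 else 0))
      as (c & _ & E).
    - rewrite Rmin_left, Rmax_right by easy. intros s Hs.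
      destruct (Rlt_dec 0 s), (Rlt_dec s T); try lra. apply Hd; lra.
    - auto.
    - destruct (Rlt_dec 0 c), (Rlt_dec c T); try nra.
      destruct (Hd c) as [_ I]; [lra|]. nra. }
  destruct (Req_dec T 0) as [->|]; [lra|].
  (* As before, the value at the endpoints is chosen to satisfy the bound sought. *)
  destruct (MVT_gen (fun s => / a s) 0 T
     (fun s => if Rlt_dec 0 s then if Rlt_dec s T then - da s / a s ^ 2 else 1 else 1))
      as (c & Hc' & E).
  - rewrite Rmin_left, Rmax_right by easy. intros s Hs.
    destruct (Rlt_dec 0 s), (Rlt_dec s T); try lra.
    apply is_derive_inv; [apply Hd; lra|]. specialize (D s). lra.
  - rewrite Rmin_left, Rmax_right by easy. intros s Hs.
    apply continuity_pt_inv; auto. specialize (D s Hs). lra.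
  - assert (K : T <= / a T - / a 0).
    { rewrite E, Rminus_0_r. rewrite <- (Rmult_1_l T) at 1.
      apply Rmult_le_compat_r; auto.
      destruct (Rlt_dec 0 c), (Rlt_dec c T); try lra.
      destruct (Hd c) as [_ I]; [lra|]. specialize (D c).
      apply Rmult_le_reg_r with (a c ^ 2); [nra|].
      replace (- da c / a c ^ 2 * a c ^ 2) with (- da c) by (field; nra). lra. }
    assert (/ a T < 0) by (apply Rinv_lt_0_compat; specialize (D T); lra).
    apply Rlt_le_trans with (- / a 0 * - a 0).
    + apply Rmult_lt_compat_r; lra.
    + right. field. lra.
Qed.

(** * The dispersive term at a dry point *)

Lemma dispersion_expand (h w : R -> R) (x dh dw : R) :
  is_derive h x dh -> is_derive w x dw ->
  dispersion h w x = h x * (dh * w x + h x / 3 * dw).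
Proof.
  intros Hh Hw. unfold dispersion.
  destruct (Req_EM_T (h x) 0) as [Z|NZ].
  - rewrite (is_derive_unique _ _ _ Hh), (is_derive_unique _ _ _ Hw). field.
  - rewrite (is_derive_unique _ _ (3 * h x ^ 2 * dh * w x + h x ^ 3 * dw)).
    + now field.
    + apply is_derive_Rmult; [|exact Hw].
      replace (3 * h x ^ 2 * dh) with (INR 3 * dh * h x ^ 2) by (simpl; ring).
      now apply is_derive_pow.
Qed.

(** By [dispersion_expand] the term is [h] times [h_x w + (h / 3) w_x], and both
    factors vanish at [x]. *)
Lemma dispersion_flat (h w dh dw : R -> R) (x : R) :
  (forall y, is_derive h y (dh y)) -> (forall y, is_derive w y (dw y)) ->
  ex_derive dh x -> ex_derive dw x -> h x = 0 -> dh x = 0 ->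
  is_derive (dispersion h w) x 0.
Proof.
  intros Hh Hw [ddh Hdh] [ddw Hdw] Z DZ.
  apply is_derive_ext with (fun y => h y * (dh y * w y + h y * (/ 3 * dw y))).
  { intros y. rewrite (dispersion_expand h w y (dh y) (dw y)) by auto.
    change (h y * (dh y * w y + h y * (/ 3 * dw y)) = h y * (dh y * w y + h y / 3 * dw y)).
    field. }
  pose proof (is_derive_Rmult h (fun y => / 3 * dw y) x _ _ (Hh x)
    (is_derive_scal dw x (/ 3) ddw Hdw)) as K1.
  pose proof (is_derive_Rmult dh w x _ _ Hdh (Hw x)) as K2.
  pose proof (is_derive_Rmult h _ x _ _ (Hh x) (is_derive_Rplus _ _ x _ _ K2 K1)) as K.
  cbv beta in K. rewrite Z, DZ in K.
  match type of K with is_derive _ _ ?e => replace e with 0 in K by ring end.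
  exact K.
Qed.

(** * Transport along characteristics *)

Lemma characteristic_exists (u : R -> R -> R) (T x0 : R) :
  smooth_on (Rle 0) u -> (forall t, 0 <= t -> periodic (u t)) -> 0 <= T ->
  exists X : R -> R, X 0 = x0 /\ (forall t, continuous X t) /\
    forall t, 0 < t < T -> is_derive X t (u t (X t)).
Proof.
  intros Hu Hp T0.
  (* The velocity is frozen outside [[0, T]] in time, where no bound uniform in
     time is available. *)
  set (clamp s := Rmax 0 (Rmin s T)).
  assert (clamp_range : forall s, 0 <= clamp s <= T).
  { intros s. unfold clamp. split; [apply Rmax_l|].
    apply Rmax_lub; [exact T0|apply Rmin_r]. }
  assert (clamp_cont : forall s, continuous clamp s).
  { intros s. apply lipschitz_continuous with 1. intros a b. apply Rabs_le.
    generalize (Rle_abs (b - a)) (Rle_abs (- (b - a))). rewrite Rabs_Ropp.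
    unfold clamp, Rmax, Rmin.
    destruct (Rle_dec a T), (Rle_dec b T); repeat destruct Rle_dec; lra. }
  destruct (periodic_bounded u T Hu Hp) as [M HM].
  destruct (periodic_bounded (Dx u) T) as [L HL].
  { now apply smooth_on_Dx. }
  { intros t t0. now apply Derive_periodic, Hp. }
  assert (L0 : 0 <= L) by (apply Rle_trans with (2 := HL 0 0 (conj (Rle_refl 0) T0)); apply Rabs_pos).
  destruct (picard_lindelof (fun s x => u (clamp s) x) x0 M (L + 1)) as (X & X0 & Xc & Xd).
  - intros s x. apply (smooth_on_continuity_comp (Rle 0)); auto. apply clamp_range.
  - intros s x. apply HM, clamp_range.
  - lra.
  - intros s x y.
    destruct (MVT_gen (u (clamp s)) y x (Dx u (clamp s))) as (c & _ & E).
    + intros z _. apply (smooth_on_is_derive_x (Rle 0)); auto. apply clamp_range.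
    + intros z _. apply continuity_pt_filterlim.
      apply (ex_derive_continuous (K := R_AbsRing) (V := R_NormedModule)).
      exists (Dx u (clamp s) z). apply (smooth_on_is_derive_x (Rle 0)); auto. apply clamp_range.
    + rewrite E, Rabs_mult. apply Rmult_le_compat_r; [apply Rabs_pos|].
      generalize (HL (clamp s) c (clamp_range s)). lra.
  - exists X. split; [|split]; auto.
    intros t [t0 tT]. generalize (Xd t t0).
    unfold clamp. now rewrite Rmin_left, Rmax_right by lra.
Qed.

Section Solution.

Variables (eta u : R -> R -> R).
Hypothesis eta_smooth : smooth_on (Rlt 0) eta.
Hypothesis u_smooth : smooth_on (Rlt 0) u.
Hypothesis mass : forall t x, 0 < t -> mass_eq eta u t x.
Hypothesis momentum : forall t x, 0 < t -> momentum_eq eta u t x.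

Let open_pos : open (Rlt 0) := open_gt 0.

Ltac dx := apply (smooth_on_is_derive_x (Rlt 0));
  [repeat first [assumption | apply smooth_on_Dx | apply smooth_on_Dt] | assumption].

Lemma mass_expanded t x : 0 < t ->
  Dt eta t x = - (Dx eta t x * u t x + (1 + eta t x) * Dx u t x).
Proof.
  intros t0. pose proof (mass t x t0) as H. unfold mass_eq in H.
  assert (E : Dx (fun s y => depth eta s y * u s y) t x
    = Dx eta t x * u t x + (1 + eta t x) * Dx u t x).
  { apply is_derive_unique.
    apply (is_derive_Rmult (depth eta t)); [apply is_derive_1plus|]; dx. }
  lra.
Qed.

Lemma mass_derived t x : 0 < t ->
  Dt (Dx eta) t x = - (Dx (Dx eta) t x * u t x + 2 * Dx eta t x * Dx u t x
    + (1 + eta t x) * Dx (Dx u) t x).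
Proof.
  intros t0. rewrite (smooth_on_Schwarz (Rlt 0)) by auto.
  apply is_derive_unique.
  apply is_derive_ext with
    (fun y => - (Dx eta t y * u t y + (1 + eta t y) * Dx u t y)).
  { intros y. symmetry. now apply mass_expanded. }
  match goal with |- is_derive _ _ (- ?e) => replace e with
    ((Dx (Dx eta) t x * u t x + Dx eta t x * Dx u t x)
     + (Dx eta t x * Dx u t x + (1 + eta t x) * Dx (Dx u) t x)) by ring end.
  apply is_derive_Ropp.
  apply (is_derive_Rplus (fun y => Dx eta t y * u t y) (fun y => (1 + eta t y) * Dx u t y)).
  - apply is_derive_Rmult; dx.
  - apply (is_derive_Rmult (fun y => 1 + eta t y)); [apply is_derive_1plus|]; dx.
Qed.

Lemma mass_derived_twice t x : 0 < t ->
  Dt (Dx (Dx eta)) t x = - (Dx (Dx (Dx eta)) t x * u t x + 3 * Dx (Dx eta) t x * Dx u t x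
    + 3 * Dx eta t x * Dx (Dx u) t x + (1 + eta t x) * Dx (Dx (Dx u)) t x).
Proof.
  intros t0. rewrite (smooth_on_Schwarz (Rlt 0)) by (auto; now apply smooth_on_Dx).
  apply is_derive_unique.
  apply is_derive_ext with
    (fun y => - (Dx (Dx eta) t y * u t y + 2 * Dx eta t y * Dx u t y
      + (1 + eta t y) * Dx (Dx u) t y)).
  { intros y. symmetry. now apply mass_derived. }
  match goal with |- is_derive _ _ (- ?e) => replace e with
    ((Dx (Dx (Dx eta)) t x * u t x + Dx (Dx eta) t x * Dx u t x)
     + (2 * Dx (Dx eta) t x * Dx u t x + 2 * Dx eta t x * Dx (Dx u) t x)
     + (Dx eta t x * Dx (Dx u) t x + (1 + eta t x) * Dx (Dx (Dx u)) t x)) by ring end.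
  apply is_derive_Ropp.
  apply (is_derive_Rplus (fun y => Dx (Dx eta) t y * u t y + 2 * Dx eta t y * Dx u t y)
     (fun y => (1 + eta t y) * Dx (Dx u) t y)).
  - apply (is_derive_Rplus (fun y => Dx (Dx eta) t y * u t y)).
    + apply is_derive_Rmult; dx.
    + apply (is_derive_Rmult (fun y => 2 * Dx eta t y)); [|dx].
      apply (is_derive_scal (Dx eta t)). dx.
  - apply (is_derive_Rmult (fun y => 1 + eta t y)); [apply is_derive_1plus|]; dx.
Qed.

(** The left-hand side is the derivative of [u_x] along a characteristic. On the
    right, both dispersive contributions are gone by [dispersion_flat], and what
    remains is the [x]-derivative of [u_t + u u_x + eta_x = 0]. *)
Lemma momentum_derived_at_vacuum t x : 0 < t ->
  1 + eta t x = 0 -> Dx eta t x = 0 ->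
  Dt (Dx u) t x + Dx (Dx u) t x * u t x = - Dx u t x ^ 2 - Dx (Dx eta) t x.
Proof.
  intros t0 Z DZ.
  set (w1 := fun y => Dx (Dt u) t y).
  set (w2 := fun y => u t y * Dx (Dx u) t y - Dx u t y ^ 2).
  set (dw2 := fun y => (Dx u t y * Dx (Dx u) t y + u t y * Dx (Dx (Dx u)) t y)
    + - (Dx (Dx u) t y * Dx u t y + Dx u t y * Dx (Dx u) t y)).
  assert (Hw2 : forall y, is_derive w2 y (dw2 y)).
  { intros y. unfold dw2.
    apply is_derive_ext with (fun y => u t y * Dx (Dx u) t y + - (Dx u t y * Dx u t y)).
    { intros z. unfold w2. ring_simplify; reflexivity. }
    apply (is_derive_Rplus (fun y => u t y * Dx (Dx u) t y)).
    - apply is_derive_Rmult; dx.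
    - apply is_derive_Ropp, is_derive_Rmult; dx. }
  assert (Hh : forall y, is_derive (depth eta t) y (Dx eta t y)).
  { intros y. apply is_derive_1plus. dx. }
  assert (F1 : is_derive (dispersion (depth eta t) w1) x 0).
  { apply dispersion_flat with (Dx eta t) (Dx (Dx (Dt u)) t); auto.
    - intros y. dx.
    - exists (Dx (Dx eta) t x). dx.
    - exists (Dx (Dx (Dx (Dt u))) t x). dx. }
  assert (F2 : is_derive (dispersion (depth eta t) w2) x 0).
  { apply dispersion_flat with (Dx eta t) dw2; auto.
    - exists (Dx (Dx eta) t x). dx.
    - unfold dw2. eexists.
      apply (is_derive_Rplus (fun y => Dx u t y * Dx (Dx u) t y + u t y * Dx (Dx (Dx u)) t y)).
      + apply (is_derive_Rplus (fun y => Dx u t y * Dx (Dx u) t y));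
          apply is_derive_Rmult; dx.
      + apply is_derive_Ropp.
        apply (is_derive_Rplus (fun y => Dx (Dx u) t y * Dx u t y));
          apply is_derive_Rmult; dx. }
  assert (A : is_derive (fun y => Dt u t y + (u t y * Dx u t y + Dx eta t y)) x
    (Dx (Dt u) t x + ((Dx u t x * Dx u t x + u t x * Dx (Dx u) t x) + Dx (Dx eta) t x))).
  { apply (is_derive_Rplus (Dt u t)); [dx|].
    apply (is_derive_Rplus (fun y => u t y * Dx u t y)); [|dx].
    apply is_derive_Rmult; dx. }
  assert (B : is_derive (fun y => Dt u t y + (u t y * Dx u t y + Dx eta t y)) x (0 + 0)).
  { apply is_derive_ext with
      (fun y => dispersion (depth eta t) w1 y + dispersion (depth eta t) w2 y).
    - intros y. generalize (momentum t y t0). unfold momentum_eq.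
      change (fun y => Dx (Dt u) t y) with w1.
      change (fun y => u t y * Dx (Dx u) t y - Dx u t y ^ 2) with w2.
      change plus with Rplus. lra.
    - now apply is_derive_Rplus. }
  rewrite (smooth_on_Schwarz (Rlt 0)) by auto.
  apply is_derive_unique in A. apply is_derive_unique in B.
  rewrite A in B. simpl. lra.
Qed.

End Solution.

(** * Blow-up *)

Lemma even_Derive_0 (f : R -> R) : even_fun f -> ex_derive f 0 -> Derive f 0 = 0.
Proof.
  intros He Hd. apply Derive_correct in Hd.
  assert (K : is_derive (fun y => f (- y)) 0 (scal (- 1) (Derive f 0))).
  { apply (is_derive_comp (K := R_AbsRing) (V := R_NormedModule) f Ropp).
    - now rewrite Ropp_0.
    - apply (is_derive_Ropp (fun y => y)), (is_derive_id (K := R_AbsRing)). }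
  apply (is_derive_ext _ f) in K; [|exact He].
  apply is_derive_unique in K.
  change (Derive f 0 = - 1 * Derive f 0) in K. lra.
Qed.

Lemma global_smooth (f : R -> R -> R) : smooth_on_life p_infty f -> smooth_on (Rle 0) f.
Proof. apply (smooth_on_mono (in_life p_infty)). now intros t t0. Qed.

Lemma smooth_on_continuous_along (f : R -> R -> R) (X : R -> R) (t : R) :
  smooth_on (Rle 0) f -> (forall s, continuous X s) ->
  continuous (fun s => f (Rmax 0 s) (X s)) t.
Proof.
  intros Hf HX. apply (continuous_comp_2d (fun s y => f (Rmax 0 s) y) (fun s => s) X).
  - apply (smooth_on_continuity_comp (Rle 0)); auto using Rmax_l, continuous_Rmax_0.
  - apply continuous_id.
  - apply HX.
Qed.

Lemma smooth_on_derive_along (f : R -> R -> R) (X : R -> R) (t v : R) :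
  smooth_on (Rle 0) f -> 0 < t -> is_derive X t v ->
  is_derive (fun s => f (Rmax 0 s) (X s)) t (Dt f t (X t) + Dx f t (X t) * v).
Proof.
  intros Hf t0 HX.
  apply is_derive_ext_loc with (fun s => f s (X s)).
  - apply filter_imp with (2 := open_gt 0 t t0).
    intros s s0. now rewrite Rmax_right by (apply Rlt_le, s0).
  - apply (smooth_on_chain (Rlt 0)); [exact (open_gt 0)| |exact t0|exact HX].
    now apply smooth_on_mono with (2 := Hf), Rlt_le.
Qed.


Lemma no_global_solution (eta0 u0 : R -> R) (eta u : R -> R -> R) :
  SGN_smooth_solution p_infty eta0 u0 eta u ->
  smooth eta0 -> even_fun eta0 -> 1 + eta0 0 = 0 -> 0 <= Derive_n eta0 2 0 ->
  Derive u0 0 < 0 -> False.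
Proof.
  intros [Hse Hsu _ Hpu Hmass Hmom Hie Hiu] Hs0 Hev Hvac Hconv Hslope.
  assert (se : smooth_on (Rle 0) eta) by now apply global_smooth.
  assert (su : smooth_on (Rle 0) u) by now apply global_smooth.
  assert (se' : smooth_on (Rlt 0) eta) by now apply smooth_on_mono with (2 := se), Rlt_le.
  assert (su' : smooth_on (Rlt 0) u) by now apply smooth_on_mono with (2 := su), Rlt_le.
  assert (mass : forall t x, 0 < t -> mass_eq eta u t x) by (intros; now apply Hmass).
  assert (mom : forall t x, 0 < t -> momentum_eq eta u t x) by (intros; now apply Hmom).
  (* Twice the lifespan allowed by the Riccati inequality. *)
  set (T := 2 / - Derive u0 0).
  assert (T0 : 0 < T) by (apply Rdiv_lt_0_compat; lra).
  destruct (characteristic_exists u T 0) as (X & X0 & Xc & Xd); auto.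
  { intros t t0. apply Hpu. now split. }
  { lra. }
  set (along f s := f (Rmax 0 s) (X s) : R).
  set (a := along (Dx u)).
  set (h := fun s => 1 + along eta s). set (p := along (Dx eta)).
  set (b := along (Dx (Dx eta))).
  assert (cont : forall f, smooth_on (Rle 0) f -> forall s, continuous (along f) s).
  { intros f Hf s. now apply smooth_on_continuous_along. }
  assert (at0 : forall f, along f 0 = f 0 0).
  { intros f. unfold along. now rewrite Rmax_left, X0 by lra. }
  assert (atp : forall f s, 0 < s -> along f s = f s (X s)).
  { intros f s s0. unfold along. now rewrite Rmax_right by lra. }
  assert (der : forall f, smooth_on (Rle 0) f -> forall s, 0 < s < T ->
    is_derive (along f) s (Dt f s (X s) + Dx f s (X s) * u s (X s))).
  { intros f Hf s Hs. apply smooth_on_derive_along; auto. lra. }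
  assert (ac : forall s, continuous a s) by now apply cont, smooth_on_Dx.
  assert (Ie : forall x, Dx eta 0 x = Derive eta0 x) by (intros; now apply Derive_ext).
  assert (H0 : forall t, 0 <= t <= T -> h t = 0).
  { intros t Ht. rewrite (linear_ode h a T t); auto.
    - unfold h. rewrite at0, Hie, Hvac. ring.
    - intros s. apply (continuous_plus (K := R_AbsRing) (V := R_NormedModule)).
      + apply continuous_const.
      + now apply cont.
    - intros s Hs. unfold h, a. rewrite !atp by lra.
      apply is_derive_1plus.
      replace (- _ * _) with (Dt eta s (X s) + Dx eta s (X s) * u s (X s)).
      + now apply der.
      + rewrite (mass_expanded eta u) by (auto; lra). ring. }
  assert (P0 : forall t, 0 <= t <= T -> p t = 0).
  { intros t Ht. rewrite (linear_ode p (fun s => 2 * a s) T t); auto.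
    - unfold p. rewrite at0, Ie, even_Derive_0; [ring|auto|exact (Hs0 1%nat 0)].
    - now apply cont, smooth_on_Dx.
    - intros s. now apply (continuous_scal_r (K := R_AbsRing) (V := R_NormedModule) 2 a).
    - intros s Hs. unfold p, a.
      assert (Z : h s = 0) by (apply H0; lra). unfold h in Z.
      rewrite !atp in * by lra.
      replace (- _ * _) with (Dt (Dx eta) s (X s) + Dx (Dx eta) s (X s) * u s (X s)).
      + apply der; auto. now apply smooth_on_Dx.
      + rewrite (mass_derived eta u), Z by (auto; lra). ring. }
  assert (B0 : forall t, 0 <= t <= T -> 0 <= b t).
  { intros t Ht. rewrite (linear_ode b (fun s => 3 * a s) T t); auto.
    - apply Rmult_le_pos; [|left; apply exp_pos].
      unfold b. rewrite at0.
      replace (Dx (Dx eta) 0 0) with (Derive_n eta0 2 0); [exact Hconv|].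
      symmetry. apply (Derive_ext (Dx eta 0) (Derive eta0)), Ie.
    - now apply cont, smooth_on_Dx, smooth_on_Dx.
    - intros s. now apply (continuous_scal_r (K := R_AbsRing) (V := R_NormedModule) 3 a).
    - intros s Hs. unfold b, a.
      assert (Z : h s = 0) by (apply H0; lra). unfold h in Z.
      assert (Y : p s = 0) by (apply P0; lra). unfold p in Y.
      rewrite !atp in * by lra.
      replace (- _ * _) with
        (Dt (Dx (Dx eta)) s (X s) + Dx (Dx (Dx eta)) s (X s) * u s (X s)).
      + apply der; auto. now apply smooth_on_Dx, smooth_on_Dx.
      + rewrite (mass_derived_twice eta u), Z, Y by (auto; lra). ring. }
  assert (A0 : a 0 = Derive u0 0).
  { unfold a. rewrite at0. now apply Derive_ext. }
  assert (life : T * - a 0 < 1).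
  { apply riccati_lifespan with
      (fun s => Dt (Dx u) s (X s) + Dx (Dx u) s (X s) * u s (X s)); auto; try lra.
    intros s Hs. split.
    - apply der; auto. now apply smooth_on_Dx.
    - assert (Z : h s = 0) by (apply H0; lra). unfold h in Z.
      assert (Y : p s = 0) by (apply P0; lra). unfold p in Y.
      assert (W : 0 <= b s) by (apply B0; lra). unfold b in W.
      unfold a. rewrite !atp in * by lra.
      rewrite (momentum_derived_at_vacuum eta u) by (auto; lra). lra. }
  rewrite A0 in life.
  replace (T * - Derive u0 0) with 2 in life by (unfold T; field; lra). lra.
Qed.

Theorem theorem2p1 :
  forall (eta0 u0 : R -> R) (eta u : R -> R -> R) (Tmax : Rbar),
    periodic eta0 -> periodic u0 ->
    (forall x, 0 <= 1 + eta0 x) ->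
    smooth eta0 -> even_fun eta0 ->
    1 + eta0 0 = 0 -> 0 <= Derive_n eta0 2 0 ->
    smooth u0 -> odd_fun u0 -> Derive u0 0 < 0 ->
    RInt eta0 (- PI) PI = 0 ->
    SGN_maximal_solution Tmax eta0 u0 eta u ->
    (forall t, in_life Tmax t -> RInt (u t) (- PI) PI = 0) ->
    Rbar_lt Tmax p_infty.
Proof.
  intros eta0 u0 eta u Tmax _ _ _ Hs0 Hev Hvac Hconv _ _ Hslope _ (Hpos & Hsol & _) _.
  destruct Tmax as [T| |]; [exact I| |easy].
  exfalso. exact (no_global_solution eta0 u0 eta u Hsol Hs0 Hev Hvac Hconv Hslope).
Qed.
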